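(* The first-order theory $\mathrm{ECBDA}$ is the model completion of the theory of Boole-De Morgan algebras. Moreover, $\mathrm{ECBDA}$ is complete and eliminates quantifiers.
   Context: A De Morgan algebra is a bounded distributive lattice $(A;+,\cdot,0,1)$ ($+$ join, $\cdot$ meet) with a unary operation $\bar{\ }$ satisfying $\bar{\bar x}=x$ and $\overline{x+y}=\bar x\cdot\bar y$. A Boole-De Morgan algebra is an algebra $(A;+,\cdot,',\bar{\ },0,1)$ such that $(A;+,\cdot,',0,1)$ is a Boolean algebra (with complement $'$) and $(A;+,\cdot,\bar{\ },0,1)$ is a De Morgan algebra. Convention: $0\neq1$. Put $x^*:=(\bar x)'=\overline{(x')}$ (the two agree in every Boole-De Morgan algebra); $^*$ is a lattice automorphism of order $2$ given by a term, and a symbol for it is added to the language. Model completion: a theory $T'$ is a model companion of $T$ if $T'$ is model complete (every formula is equivalent modulo $T'$ to an existential one), every model of $T$ embeds into a model of $T'$, and every model of $T'$ embeds into a model of $T$. If $T$ has the amalgamation property (for models $M_0,M_1,M_2$ of $T$ and embeddings $f_i:M_0\to M_i$, $i=1,2$, there are a model $M$ of $T$ and embeddings $g_i:M_i\to M$ with $g_1f_1=g_2f_2$), a model companion of $T$ is called its model completion. Consistency: for $\sigma\in S_n$, a triple $(I_1,I_2,I_3)$ of subsets of $\{1,\dots,n\}$ is $\sigma$-consistent if $\sigma(I_2)=I_2$, $\sigma(I_3)=I_3$, and $(I_1\cap I_2\cap I_3)\cap\sigma(I_1\cap I_2\cap I_3)=\emptyset$. Formulas: for $y=(y_1,\dots,y_n)$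 and $I_1,I_2,I_3\subseteq\{1,\dots,n\}$, $\varphi^n_{(I_1,I_2,I_3)}(y,x)$ is the conjunction of $$\bigwedge_{i\in I_1}y_i\cdot x\bar x=0\wedge\bigwedge_{i\notin I_1}y_i\cdot x\bar x\neq0,\quad \bigwedge_{i\in I_2}y_i\cdot xx^*=0\wedge\bigwedge_{i\notin I_2}y_i\cdot xx^*\neq0,\quad \bigwedge_{i\in I_3}y_i\cdot x'\bar x=0\wedge\bigwedge_{i\notin I_3}y_i\cdot x'\bar x\neq0.$$ The theory $\mathrm{ECBDA}$ consists of the axioms of Boole-De Morgan algebras and the sentences $$\forall y_1,\dots,y_n\Big(\bigwedge_iy_i\neq0\wedge\sum_{i=1}^ny_i=1\wedge\bigwedge_{i\neq j}y_i\cdot y_j=0\wedge\bigwedge_iy_i^*=y_{\sigma(i)}\rightarrow\exists x\,\varphi^n_{(I_1,I_2,I_3)}(y,x)\Big)$$ for each integer $n\ge1$, each $\sigma\in S_n$ with $\sigma^2$ the identity, and each $\sigma$-consistent triple $(I_1,I_2,I_3)$ of subsets of $\{1,\dots,n\}$. *)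

(* Defs.v *)
From Stdlib Require List.
From mathcomp Require Import all_boot all_fingroup.

Set Implicit Arguments.
Unset Strict Implicit.
Unset Printing Implicit Defensive.

Declare Scope fo_scope.
Delimit Scope fo_scope with fo.

Record signature := Signature { symbol : Type; arity : symbol -> nat }.

Inductive term (L : signature) (n : nat) : Type :=
| Var of 'I_n
| App (f : symbol L) of ('I_(arity f) -> term L n).

(** [formula L n] has its free variables among [0, ..., n-1].  Variables are
    de Bruijn levels: a quantifier binds the _last_ variable [ord_max] of its
    body, so the other variables keep their index under a quantifier. *)
Inductive formula (L : signature) : nat -> Type :=
| Bot n : formula L n
| Eq n of term L n & term L n : formula L n
| And n of formula L n & formula L n : formula L n
| Or n of formula L n & formula L n : formula L n
| Imp n of formula L n & formula L n : formula L n
| All n of formula L n.+1 : formula L n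
| Ex n of formula L n.+1 : formula L n.

Arguments Var {L n}.
Arguments App {L n}.
Arguments Bot {L n}.
Arguments Eq {L n}.
Arguments And {L n}.
Arguments Or {L n}.
Arguments Imp {L n}.
Arguments All {L n}.
Arguments Ex {L n}.

Definition Not L n (p : formula L n) : formula L n := Imp p Bot.
Definition Top {L n} : formula L n := Not Bot.

Notation "s == t" := (Eq s t) : fo_scope.
Notation "s != t" := (Not (Eq s t)) : fo_scope.
Notation "p /\ q" := (And p q) : fo_scope.
Notation "p ==> q" := (Imp p q) : fo_scope.

Definition sentence L := formula L 0.
Definition theory L := sentence L -> Prop.

Fixpoint universal_closure L n : formula L n -> sentence L :=
  if n is m.+1 then fun p => universal_closure (All p) else fun p => p.

Record structure (L : signature) := Structure {
  carrier :> Type;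
  interp : forall f : symbol L, ('I_(arity f) -> carrier) -> carrier;
  carrier_inhabited : inhabited carrier
}.

Section Semantics.
Variables (L : signature) (M : structure L).

Fixpoint eval n (v : 'I_n -> M) (t : term L n) : M :=
  match t with
  | Var i => v i
  | App f a => interp (fun i => eval v (a i))
  end.

Definition extend n (v : 'I_n -> M) (a : M) : 'I_n.+1 -> M :=
  fun i => oapp v a (unlift ord_max i).

Fixpoint holds n (p : formula L n) : ('I_n -> M) -> Prop :=
  match p in formula _ n return ('I_n -> M) -> Prop with
  | Bot _ => fun _ => False
  | Eq _ s t => fun v => eval v s = eval v t
  | And _ p q => fun v => holds p v /\ holds q v
  | Or _ p q => fun v => holds p v \/ holds q v
  | Imp _ p q => fun v => holds p v -> holds q v
  | All _ p => fun v => forall a : M, holds p (extend v a)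
  | Ex _ p => fun v => exists a : M, holds p (extend v a)
  end.

Definition empty_valuation : 'I_0 -> M :=
  fun i => let: Ordinal _ lt_i0 := i in False_rect M (notF lt_i0).

Definition satisfies (p : sentence L) : Prop := holds p empty_valuation.

Definition model (T : theory L) : Prop := forall p, T p -> satisfies p.

End Semantics.

Definition embedding L (M N : structure L) (f : M -> N) : Prop :=
  injective f /\
  forall (s : symbol L) (a : 'I_(arity s) -> M),
    f (interp a) = interp (fun i => f (a i)).

Definition embeds L (M N : structure L) : Prop :=
  exists f : M -> N, embedding f.

Fixpoint quantifier_free L n (p : formula L n) : bool :=
  match p with
  | Bot _ | Eq _ _ _ => true
  | And _ p q | Or _ p q | Imp _ p q => quantifier_free p && quantifier_free q
  | All _ _ | Ex _ _ => false
  end.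

Fixpoint existential L n (p : formula L n) : bool :=
  if p is Ex _ q then existential q else quantifier_free p.

Section Theories.
Variable L : signature.
Implicit Types T : theory L.

Definition entails T (p : sentence L) : Prop :=
  forall M : structure L, model M T -> satisfies M p.

Definition equivalent_mod T n (p q : formula L n) : Prop :=
  forall M : structure L, model M T ->
  forall v : 'I_n -> M, holds p v <-> holds q v.

Definition satisfiable T : Prop := exists M : structure L, model M T.

Definition complete T : Prop :=
  satisfiable T /\ forall p : sentence L, entails T p \/ entails T (Not p).

Definition eliminates_quantifiers T : Prop :=
  forall n (p : formula L n),
    exists2 q : formula L n, quantifier_free q & equivalent_mod T p q.

Definition model_complete T : Prop :=
  forall n (p : formula L n),
    exists2 q : formula L n, existential q & equivalent_mod T p q.

Definition model_companion T' T : Prop :=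
  [/\ model_complete T',
      forall M : structure L, model M T ->
        exists2 N : structure L, model N T' & embeds M N
    & forall M : structure L, model M T' ->
        exists2 N : structure L, model N T & embeds M N].

Definition amalgamation T : Prop :=
  forall (M0 M1 M2 : structure L) (f1 : M0 -> M1) (f2 : M0 -> M2),
    model M0 T -> model M1 T -> model M2 T -> embedding f1 -> embedding f2 ->
  exists (M : structure L) (g1 : M1 -> M) (g2 : M2 -> M),
    [/\ model M T, embedding g1, embedding g2
      & forall a : M0, g1 (f1 a) = g2 (f2 a)].

Definition model_completion T' T : Prop :=
  amalgamation T /\ model_companion T' T.

End Theories.

Variant bdm_symbol :=
  JoinSym | MeetSym | ComplSym | BarSym | StarSym | ZeroSym | OneSym.

Definition bdm_arity (f : bdm_symbol) : nat :=
  match f with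
  | JoinSym | MeetSym => 2
  | ComplSym | BarSym | StarSym => 1
  | ZeroSym | OneSym => 0
  end.

Definition bdm : signature := Signature bdm_arity.

Section Terms.
Variable n : nat.
Implicit Types s t : term bdm n.

Definition join s t : term bdm n := @App bdm n JoinSym (tnth [tuple s; t]).
Definition meet s t : term bdm n := @App bdm n MeetSym (tnth [tuple s; t]).
Definition compl s : term bdm n := @App bdm n ComplSym (tnth [tuple s]).
Definition bar s : term bdm n := @App bdm n BarSym (tnth [tuple s]).
Definition star s : term bdm n := @App bdm n StarSym (tnth [tuple s]).
Definition zero : term bdm n := @App bdm n ZeroSym (tnth [tuple]).
Definition one : term bdm n := @App bdm n OneSym (tnth [tuple]).
End Terms.

Arguments zero {n}.
Arguments one {n}.

Notation "s + t" := (join s t) : fo_scope.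
Notation "s * t" := (meet s t) : fo_scope.
Notation "0" := zero : fo_scope.
Notation "1" := one : fo_scope.

Definition bda_identities : seq (formula bdm 3) :=
  let x := Var (@Ordinal 3 0 isT) in
  let y := Var (@Ordinal 3 1 isT) in
  let z := Var (@Ordinal 3 2 isT) in
  [:: x + (y + z) == (x + y) + z;
      x * (y * z) == (x * y) * z;
      x + y == y + x;
      x * y == y * x;
      x + x * y == x;
      x * (x + y) == x;
      x * (y + z) == x * y + x * z;
      x + 0 == x;
      x * 1 == x;
      x + compl x == 1;
      x * compl x == 0;
      bar (bar x) == x;
      bar (x + y) == bar x * bar y;
      star x == compl (bar x)]%fo.

Definition BDA : theory bdm := fun p =>
  p = (0 != 1)%fo \/ exists2 q, List.In q bda_identities & p = universal_closure q.

Definition consistent n (s : 'S_n) (I1 I2 I3 : {set 'I_n}) : Prop :=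
  [/\ s @: I2 = I2, s @: I3 = I3
    & (I1 :&: I2 :&: I3) :&: s @: (I1 :&: I2 :&: I3) = set0].

(** In context [n.+1] the variables are [y_0, ..., y_(n-1), x]. *)
Definition phi n (I1 I2 I3 : {set 'I_n}) : formula bdm n.+1 :=
  let x := Var ord_max in
  let y i := Var (lift ord_max i) in
  let vanishing_pattern (I : {set 'I_n}) (t : term bdm n.+1) :=
    (\big[And/Top]_(i < n | i \in I) (y i * t == 0) /\
     \big[And/Top]_(i < n | i \notin I) (y i * t != 0))%fo in
  (vanishing_pattern I1 (x * bar x) /\
   vanishing_pattern I2 (x * star x) /\
   vanishing_pattern I3 (compl x * bar x))%fo.

Definition star_partition n (s : 'S_n) : formula bdm n :=
  let y i := Var i in
  (\big[And/Top]_(i < n) (y i != 0) /\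
   \big[@join n/0]_(i < n) y i == 1 /\
   \big[And/Top]_(i < n) \big[And/Top]_(j < n | i != j) (y i * y j == 0) /\
   \big[And/Top]_(i < n) (star (y i) == y (s i)))%fo.

Definition extension_axiom n (s : 'S_n) (I1 I2 I3 : {set 'I_n}) :
    sentence bdm :=
  universal_closure (star_partition s ==> Ex (phi I1 I2 I3))%fo.

Variant ECBDA : theory bdm :=
| ECBDA_bda p of BDA p : ECBDA p
| ECBDA_extension n (s : 'S_n) (I1 I2 I3 : {set 'I_n}) of
    (0 < n)%N & (s * s)%g = 1%g & consistent s I1 I2 I3 :
    ECBDA (extension_axiom s I1 I2 I3).

(* Main.v *)
(** Every Boole-De Morgan algebra is a subdirect power of the four-element
    algebra [four] of pairs of booleans, with [star] the swap: an ultrafilter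
    [U] gives the homomorphism [a |-> (a \in U, star a \in U)].  Hence the
    quantifier-free type of a tuple [v] in [M] amounts to the finite set
    [types v] of images of [v] under the homomorphisms [M -> four].

    In a model of ECBDA the sets [types (extend v a)], for [a] in [M], are
    exactly the swap-invariant sets that restrict to [types v]: this is the
    extension axiom for the partition formed by the nonzero minterms of [v].
    So the truth of any formula at [v] depends only on [types v], which gives
    quantifier elimination, and completeness because there is only one
    possible set of types for the empty tuple.

    Two algebras over [M0] amalgamate in the power of [four] indexed by the
    pairs of homomorphisms that agree on [M0].  An algebra [M] embeds into the
    algebra of functions to [four] on the product of [nat -> four] and the set
    of homomorphisms [M -> four] that depend on finitely many coordinates of
    the first factor; a fresh coordinate provides a witness for each extension
    axiom. *)

From Stdlib Require List.
From mathcomp Require Import all_boot all_fingroup.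
From mathcomp Require Import boolp.
From mathcomp Require classical_sets.
Require Import Defs.

Set Implicit Arguments.
Unset Strict Implicit.
Unset Printing Implicit Defensive.

(** * Homomorphisms, valuations and finite conjunctions and disjunctions *)

Definition hom L (M N : structure L) (h : M -> N) : Prop :=
  forall (s : symbol L) (a : 'I_(arity s) -> M),
    h (interp a) = interp (fun i => h (a i)).

Lemma hom_comp L (M N P : structure L) (g : N -> P) (h : M -> N) :
  hom g -> hom h -> hom (g \o h).
Proof. by move=> gH hH s a; rewrite /= hH gH. Qed.

Lemma hom_eval L (M N : structure L) (h : M -> N) n (v : 'I_n -> M) t :
  hom h -> h (eval v t) = eval (h \o v) t.
Proof.
move=> hH; elim: t => //= f a IH; rewrite hH; congr interp.
by apply: funext => i; rewrite IH.
Qed.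

Section Valuations.
Variables (L : signature) (M : structure L).

Lemma extend_lift n (v : 'I_n -> M) a i : extend v a (lift ord_max i) = v i.
Proof. by rewrite /extend liftK. Qed.

Lemma extend_max n (v : 'I_n -> M) a : extend v a ord_max = a.
Proof. by rewrite /extend unlift_none. Qed.

Lemma extend_eta n (w : 'I_n.+1 -> M) :
  extend (fun i => w (lift ord_max i)) (w ord_max) = w.
Proof.
apply: funext => j.
by case: (unliftP ord_max j) => [i|] ->; rewrite ?extend_lift ?extend_max.
Qed.

Lemma satisfies_universal_closure n (p : formula L n) :
  satisfies M (universal_closure p) <-> forall v, holds (M := M) p v.
Proof.
elim: n p => [|n IH] p /=.
  split=> [Mp v | ]; last exact.
  by rewrite (_ : v = @empty_valuation L M) //; apply: funext => -[].
rewrite IH /=; split=> [Mp w | Mp v a]; last exact: Mp.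
by rewrite -(extend_eta w); apply: Mp.
Qed.

Lemma holds_bigAnd n (I : finType) (P : pred I) (F : I -> formula L n) v :
  holds (M := M) (\big[And/Top]_(i | P i) F i) v <->
  forall i, P i -> holds (F i) v.
Proof.
suff H (r : seq I) : holds (M := M) (\big[And/Top]_(i <- r | P i) F i) v <->
    forall i, i \in r -> P i -> holds (F i) v.
  rewrite H; split=> Q i; last by move=> _; exact: Q.
  exact: (Q i (mem_index_enum i)).
elim: r => [|j r IH]; first by rewrite big_nil; split=> [_ i|_ []].
rewrite big_cons; case: ifP => Pj /=; rewrite IH; split.
- by case=> Fj Q i; rewrite inE => /orP[/eqP-> | /Q].
- by move=> Q; split=> [|i ir]; apply: Q; rewrite // inE ?eqxx ?ir ?orbT.
- by move=> Q i; rewrite inE => /orP[/eqP-> | /Q //]; rewrite Pj.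
- by move=> Q i ir; apply: Q; rewrite inE ir orbT.
Qed.

Lemma holds_bigOr n (I : finType) (P : pred I) (F : I -> formula L n) v :
  holds (M := M) (\big[Or/Bot]_(i | P i) F i) v <->
  exists2 i, P i & holds (F i) v.
Proof.
suff H (r : seq I) : holds (M := M) (\big[Or/Bot]_(i <- r | P i) F i) v <->
    exists2 i, (i \in r) && P i & holds (F i) v.
  rewrite H; split=> -[i]; first by case/andP=> _ Pi; exists i.
  by move=> Pi; exists i; rewrite // mem_index_enum.
elim: r => [|j r IH]; first by rewrite big_nil; split=> // -[].
rewrite big_cons; case: ifP => Pj /=; rewrite IH; split.
- case=> [Fj | [i /andP[ir Pi] Fi]]; first by exists j; rewrite // inE eqxx.
  by exists i; rewrite // inE ir orbT.
- case=> i; rewrite inE => /andP[/orP[/eqP-> | ir] Pi] Fi; first by left.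
  by right; exists i; rewrite // ir.
- by case=> i /andP[ir Pi] Fi; exists i; rewrite // inE ir orbT.
- case=> i; rewrite inE => /andP[/orP[/eqP-> | ir] Pi] Fi.
    by rewrite Pj in Pi.
  by exists i; rewrite // ir.
Qed.

End Valuations.

(** * The four-element algebra *)

Definition swap (d : bool * bool) : bool * bool := (d.2, d.1).

Lemma swapK : involutive swap. Proof. by case. Qed.

Definition four_op (f : bdm_symbol) :
    ('I_(bdm_arity f) -> bool * bool) -> bool * bool :=
  match f with
  | JoinSym => fun a =>
      ((a ord0).1 || (a ord_max).1, (a ord0).2 || (a ord_max).2)
  | MeetSym => fun a =>
      ((a ord0).1 && (a ord_max).1, (a ord0).2 && (a ord_max).2)
  | ComplSym => fun a => (~~ (a ord0).1, ~~ (a ord0).2)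
  | BarSym => fun a => (~~ (a ord0).2, ~~ (a ord0).1)
  | StarSym => fun a => swap (a ord0)
  | ZeroSym => fun _ => (false, false)
  | OneSym => fun _ => (true, true)
  end.

Definition four : structure bdm :=
  @Structure bdm (bool * bool)%type four_op (inhabits (true, true)).

Lemma swap_hom : hom (swap : four -> four).
Proof. by case. Qed.

(** Proved by running through all values in [four]. Exposing each axiom as an equation between terms
    allows its transport along homomorphisms. *)
Lemma four_identities q : List.In q bda_identities ->
  exists s t, q = Eq s t /\ forall v : 'I_3 -> four, eval v s = eval v t.
Proof.
rewrite /bda_identities => qI.
repeat (destruct qI as [<- | qI];
  [by do 2!eexists; split=> // v;
    rewrite /= ?(tnth_nth (Var ord0)) /= /four_op /swap /=;
    repeat (case: (v _) => -[] []) | ]).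
by [].
Qed.
(** * Ultrafilters and homomorphisms to the four-element algebra *)

Section Operations.
Variable M : structure bdm.

Definition jn (a b : M) : M := @interp _ M JoinSym (tnth [tuple a; b]).
Definition mt (a b : M) : M := @interp _ M MeetSym (tnth [tuple a; b]).
Definition cp (a : M) : M := @interp _ M ComplSym (tnth [tuple a]).
Definition br (a : M) : M := @interp _ M BarSym (tnth [tuple a]).
Definition st (a : M) : M := @interp _ M StarSym (tnth [tuple a]).
Definition bt : M := @interp _ M ZeroSym (tnth [tuple]).
Definition tp : M := @interp _ M OneSym (tnth [tuple]).

Lemma tuple2_eta (T : Type) (a : 'I_2 -> T) :
  a = tnth [tuple a ord0; a ord_max].
Proof.
apply: funext; case; case=> [|[|//]] i; rewrite (tnth_nth (a ord0)) /=;
  by congr a; apply: val_inj.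
Qed.

Lemma tuple1_eta (T : Type) (a : 'I_1 -> T) : a = tnth [tuple a ord0].
Proof. by apply: funext => i; rewrite (ord1 i) (tnth_nth (a ord0)). Qed.

Lemma tuple0_eta (T : Type) (a : 'I_0 -> T) : a = tnth [tuple].
Proof. by apply: funext; case. Qed.

(** An argument function need not literally be a tuple, for instance after a homomorphism is applied
    to it pointwise; extensionality restores that form. *)
Lemma interpE (f : bdm_symbol) (a : 'I_(bdm_arity f) -> M) :
  @interp bdm M f a =
  match f return ('I_(bdm_arity f) -> M) -> M with
  | JoinSym => fun a => jn (a ord0) (a ord_max)
  | MeetSym => fun a => mt (a ord0) (a ord_max)
  | ComplSym => fun a => cp (a ord0)
  | BarSym => fun a => br (a ord0)
  | StarSym => fun a => st (a ord0)
  | ZeroSym => fun _ => bt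
  | OneSym => fun _ => tp
  end a.
Proof.
case: f a => a /=; congr interp;
  [exact: tuple2_eta | exact: tuple2_eta | exact: tuple1_eta | exact: tuple1_eta
  | exact: tuple1_eta | exact: tuple0_eta | exact: tuple0_eta].
Qed.

Variables (n : nat) (v : 'I_n -> M).

Lemma eval_join s t : eval v (join s t) = jn (eval v s) (eval v t).
Proof. by rewrite /= interpE. Qed.
Lemma eval_meet s t : eval v (meet s t) = mt (eval v s) (eval v t).
Proof. by rewrite /= interpE. Qed.
Lemma eval_compl s : eval v (compl s) = cp (eval v s).
Proof. by rewrite /= interpE. Qed.
Lemma eval_bar s : eval v (bar s) = br (eval v s).
Proof. by rewrite /= interpE. Qed.
Lemma eval_star s : eval v (star s) = st (eval v s).
Proof. by rewrite /= interpE. Qed.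
Lemma eval_zero : eval v zero = bt.
Proof. by rewrite /= interpE. Qed.
Lemma eval_one : eval v one = tp.
Proof. by rewrite /= interpE. Qed.

Definition evalE :=
  (eval_join, eval_meet, eval_compl, eval_bar, eval_star, eval_zero, eval_one).

End Operations.

Arguments bt {M}.
Arguments tp {M}.

Lemma homE (M N : structure bdm) (h : M -> N) : hom h ->
  ((forall a b, h (jn a b) = jn (h a) (h b)) *
   (forall a b, h (mt a b) = mt (h a) (h b)) *
   (forall a, h (cp a) = cp (h a)) *
   (forall a, h (br a) = br (h a)) *
   (forall a, h (st a) = st (h a)) *
   (h bt = bt) * (h tp = tp))%type.
Proof. by move=> hH; do !split; move=> *; rewrite hH interpE. Qed.

Lemma fourE :
  ((forall a b : four, jn a b = (a.1 || b.1, a.2 || b.2)) *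
   (forall a b : four, mt a b = (a.1 && b.1, a.2 && b.2)) *
   (forall a : four, cp a = (~~ a.1, ~~ a.2)) *
   (forall a : four, br a = (~~ a.2, ~~ a.1)) *
   (forall a : four, st a = (a.2, a.1)) *
   (@bt four = (false, false)) * (@tp four = (true, true)))%type.
Proof. by []. Qed.

Section Laws.
Variable M : structure bdm.
Hypothesis M_BDA : model M BDA.
Implicit Types a b c : M.

Lemma BDA_identity (q : formula bdm 3) (v : 'I_3 -> M) :
  List.In q bda_identities -> holds q v.
Proof.
move=> qI; apply: (proj1 (@satisfies_universal_closure _ M _ q)).
by apply: M_BDA; right; exists q.
Qed.

Ltac use_identity a b c k :=
  have := @BDA_identity (nth Bot bda_identities k) (tnth [tuple a; b; c]);
  rewrite /bda_identities /nth /holds !evalE; apply; rewrite /=; tauto.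

Lemma mtA a b c : mt a (mt b c) = mt (mt a b) c.
Proof. use_identity a b c 1. Qed.
Lemma jnC a b : jn a b = jn b a.
Proof. use_identity a b b 2. Qed.
Lemma mtC a b : mt a b = mt b a.
Proof. use_identity a b b 3. Qed.
Lemma jn_mt a b : jn a (mt a b) = a.
Proof. use_identity a b b 4. Qed.
Lemma mt_jn a b : mt a (jn a b) = a.
Proof. use_identity a b b 5. Qed.
Lemma mt_jnr a b c : mt a (jn b c) = jn (mt a b) (mt a c).
Proof. use_identity a b c 6. Qed.
Lemma jn_bt a : jn a bt = a.
Proof. use_identity a a a 7. Qed.
Lemma mt_tp a : mt a tp = a.
Proof. use_identity a a a 8. Qed.
Lemma jn_cp a : jn a (cp a) = tp.
Proof. use_identity a a a 9. Qed.
Lemma mt_cp a : mt a (cp a) = bt.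
Proof. use_identity a a a 10. Qed.
Lemma brK a : br (br a) = a.
Proof. use_identity a a a 11. Qed.
Lemma br_jn a b : br (jn a b) = mt (br a) (br b).
Proof. use_identity a b b 12. Qed.
Lemma stE a : st a = cp (br a).
Proof. use_identity a a a 13. Qed.

Lemma bt_neq_tp : bt <> tp :> M.
Proof.
have: satisfies M (Not (Eq zero one)) by apply: M_BDA; left.
by rewrite /satisfies /= !interpE.
Qed.

Lemma mtxx a : mt a a = a.
Proof. by rewrite -{2}(jn_mt a a) mt_jn. Qed.

Lemma mt_bt a : mt a bt = bt.
Proof. by rewrite -[LHS]jn_bt jnC mtC jn_mt. Qed.

Lemma br_bt : br bt = tp :> M.
Proof.
by rewrite -[LHS]mt_tp -{1}(brK tp) -br_jn jnC jn_bt brK.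
Qed.

Lemma br_tp : br tp = bt :> M.
Proof. by rewrite -br_bt brK. Qed.

Lemma br_mt a b : br (mt a b) = jn (br a) (br b).
Proof. by rewrite -[RHS]brK br_jn !brK. Qed.

Lemma mt_cp_eq a b : mt a (cp b) = bt -> mt a b = a.
Proof. by move=> ab0; rewrite -[RHS]mt_tp -(jn_cp b) mt_jnr ab0 jn_bt. Qed.

(** This is what makes an ultrafilter prime: it cannot contain [jn a b] together with both
    complements. *)
Lemma mt_cp2_jn a b : mt (mt (cp a) (cp b)) (jn a b) = bt.
Proof.
rewrite mt_jnr -[mt _ b]mtA [mt (cp b) b]mtC mt_cp mt_bt jn_bt.
by rewrite mtC mtA mt_cp mtC mt_bt.
Qed.

(** The lattice order is expressed by [mt a b = a]. *)
Record proper_filter (F : M -> Prop) : Prop := ProperFilter {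
  filter_tp : F tp;
  filter_mt : forall a b, F a -> F b -> F (mt a b);
  filter_up : forall a b, F a -> mt a b = a -> F b;
  filter_bt : ~ F bt }.

(** Zorn's lemma gives a filter that is maximal among the proper filters containing [F], and
    maximality forces it to decide every element. *)
Lemma ultrafilter_lemma F : proper_filter F ->
  exists2 U, proper_filter U /\ (forall a, F a -> U a) &
    forall a, U a \/ U (cp a).
Proof.
move=> FF; pose T := {G : M -> Prop | proper_filter G /\ forall a, F a -> G a}.
pose R (G H : T) := `[< forall a, sval G a -> sval H a >].
have [t|r s t /asboolP rs /asboolP sz|[G GP] [H HP]|A Atot|[U [UF FU]] Umax] :=
    @classical_sets.Zorn T R.
- exact/asboolP.
- by apply/asboolP => a /rs/sz.
- move=> /asboolP/= GH /asboolP/= HG.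
  have eGH : G = H.
    by apply: funext => a; apply: propext; split; [apply: GH | apply: HG].
  by subst H; congr exist; apply: Prop_irrelevance.
(* The empty chain is bounded by [F] itself, a nonempty one by its union. *)
- have [[G0 AG0] | A0] := pselect (exists G, A G); last first.
    exists (exist _ F (conj FF (fun a Fa => Fa))) => G AG.
    by case: A0; exists G.
  pose G a := exists2 H : T, A H & sval H a.
  have GP : proper_filter G /\ forall a, F a -> G a.
    split; last by move=> a Fa; exists G0 => //; apply: (svalP G0).2.
    split=> [|a b [H AH Ha] [K AK Kb]|a b [H AH Ha] ab|[H AH]].
    - by exists G0 => //; apply: filter_tp (svalP G0).1.
    - have [/asboolP HK | /asboolP KH] := Atot _ _ AH AK.
        by exists K => //; apply: (filter_mt (svalP K).1) => //; apply: HK.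
      by exists H => //; apply: (filter_mt (svalP H).1) => //; apply: KH.
    - by exists H => //; apply: (filter_up (svalP H).1) ab.
    - exact: filter_bt (svalP H).1.
  by exists (exist _ G GP) => H AH; apply/asboolP => a Ha; exists H.
exists U => // a; have [|nUa] := pselect (U a); first by left.
(* An element [u] of [U] disjoint from [a] lies below [cp a], which settles the first case. *)
right; have [[u Uu ua] | nz] := pselect (exists2 u, U u & mt u a = bt).
  apply: (filter_up UF Uu); rewrite -[RHS]mt_tp -(jn_cp a) mt_jnr ua.
  by rewrite jnC jn_bt.
(* [V] is the filter generated by [U] and [a]. It is proper by [nz], so maximality gives [V = U] and
   puts [a] in [U], a contradiction. *)
pose V b := exists2 u, U u & mt (mt u a) b = mt u a.
have VP : proper_filter V /\ forall b, F b -> V b.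
  split; last first.
    move=> b /FU Ub; exists b => //.
    by rewrite mtC mtA mtxx.
  split=> [|b c [u Uu ub] [w Uw wc]|b c [u Uu ub] bc|[u Uu]].
  - by exists tp; [apply: filter_tp | rewrite mt_tp].
  - exists (mt u w); first exact: filter_mt.
    have -> : mt (mt u w) a = mt (mt u a) (mt w a).
      by rewrite -!mtA; congr mt; rewrite mtA [mt a w]mtC -mtA mtxx.
    rewrite mtA -[mt (mt (mt u a) _) b]mtA [mt (mt w a) b]mtC mtA ub.
    by rewrite -mtA wc.
  - by exists u => //; rewrite -ub -mtA bc.
  - by rewrite mt_bt => /esym ua; apply: nz; exists u.
have /(Umax (exist _ V VP))[eUV] :
    R (exist _ U (conj UF FU)) (exist _ V VP).
  apply/asboolP => b Ub /=; exists b => //.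
  by rewrite mtC mtA mtxx.
case: nUa; rewrite -eUV; exists tp; first exact: filter_tp.
by rewrite -mtA mtxx.
Qed.

(** Membership in an ultrafilter above [F] respects the Boolean operations. The second component
    works because [br] exchanges joins and meets and, as far as membership can tell, commutes with
    [cp]. *)
Lemma four_hom_of_filter F : proper_filter F ->
  exists2 h : M -> four, hom h & forall a, F a -> (h a).1.
Proof.
move=> /ultrafilter_lemma[U [UF FU] Uor].
pose p a := `[< U a >].
have pmt a b : p (mt a b) = p a && p b.
  apply/asboolP/andP => [Uab | [/asboolP Ua /asboolP Ub]];
    last exact: filter_mt.
  split; apply/asboolP; apply: (filter_up UF Uab).
    by rewrite [mt a b]mtC -mtA mtxx.
  by rewrite -mtA mtxx.
have pcp a : p (cp a) = ~~ p a.
  apply/asboolP/idP => [Ua' | /asboolP nUa]; last by case: (Uor a).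
  apply/asboolP => Ua; apply: (filter_bt UF).
  by rewrite -(mt_cp a); apply: filter_mt.
have pbt : p bt = false by apply/asboolP; apply: filter_bt UF.
have ptp : p tp by apply/asboolP; apply: filter_tp.
have pjn a b : p (jn a b) = p a || p b.
  apply/idP/idP => [Uab | /orP[] /asboolP Uab].
  - rewrite -[p a || _]negbK negb_or -!pcp -pmt.
    by apply/negP => Ucc; move: pbt; rewrite -(mt_cp2_jn a b) pmt Ucc Uab.
  - apply/asboolP; apply: (filter_up UF Uab); exact: mt_jn.
  - apply/asboolP; apply: (filter_up UF Uab); rewrite jnC; exact: mt_jn.
have pst a : p (st a) = ~~ p (br a) by rewrite stE pcp.
have pbr a : p (br a) = ~~ p (st a) by rewrite pst negbK.
(* By the De Morgan laws [br a] and [br (cp a)] have join [tp] and meet [bt], so exactly one of them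
   is in [U]. *)
have pbrcp a : p (br (cp a)) = ~~ p (br a).
  have := pjn (br a) (br (cp a)); rewrite -br_mt mt_cp br_bt ptp.
  have := pmt (br a) (br (cp a)); rewrite -br_jn jn_cp br_tp pbt.
  by case: (p (br a)); case: (p _).
exists (fun a => (p a, p (st a))); last by move=> a Fa; apply/asboolP/FU.
case=> a; rewrite [RHS]/= /swap [LHS]/= interpE /=; congr pair; rewrite ?pst //.
- by rewrite br_jn pmt negb_and.
- by rewrite br_mt pjn negb_or.
- by rewrite pbrcp.
- by rewrite negbK.
- by rewrite brK.
- by rewrite stE pbrcp brK negbK.
- by rewrite br_bt ptp.
- by rewrite br_tp pbt.
Qed.

(** If [c] is not below [d], then [mt c (cp d)] is nonzero and the filter above it is proper; a
    homomorphism obtained from it is true at [c] and false at [d] in the first component. *)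
Lemma four_homs_separate a b :
  (forall h : M -> four, hom h -> (h a).1 = (h b).1) -> a = b.
Proof.
suff sub c d : (forall h : M -> four, hom h -> (h c).1 = (h d).1) -> mt c d = c.
  by move=> ab; rewrite -(sub a b) // mtC sub // => h hH; rewrite ab.
move=> cd; apply: mt_cp_eq; apply: contrapT => nz.
have [|h hH /(_ (mt c (cp d)))] :=
    @four_hom_of_filter (fun x => mt (mt c (cp d)) x = mt c (cp d)).
  split=> [|x y cx cy|x y <- xy|]; rewrite ?mt_tp //.
  - by rewrite mtA cx cy.
  - by rewrite -mtA xy.
  - by rewrite mt_bt => /esym.
rewrite mtxx !(homE hH) !fourE /= cd // => /(_ erefl).
by case: (h d).1.
Qed.

End Laws.

(** This is the injectivity of [four]. The images under [f] of the elements where [h] has first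
    component true generate a filter of [N], proper because [f] is injective. *)
Lemma four_hom_extension (M N : structure bdm) (f : M -> N) (h : M -> four) :
  model M BDA -> model N BDA -> embedding f -> hom h ->
  exists2 g : N -> four, hom g & forall a, g (f a) = h a.
Proof.
move=> MB NB [f_inj fH] hH.
have fE := homE (fH : hom f).
have [|g gH gP] := @four_hom_of_filter N NB
    (fun b => exists2 a, (h a).1 & mt (f a) b = f a).
  split=> [|b c [x hx xb] [y hy yc]|b c [x hx xb] bc|[x hx]].
  - by exists tp; rewrite ?(homE hH) // mt_tp.
  - exists (mt x y); first by rewrite (homE hH) fourE /= hx hy.
    rewrite fE mtA // -[mt (mt (f x) (f y)) b]mtA // [mt (f y) b]mtC // mtA //.
    by rewrite xb -mtA // yc.
  - by exists x => //; rewrite -xb -mtA // bc.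
  - rewrite mt_bt // -fE => /f_inj x0.
    by rewrite -x0 (homE hH) in hx.
have gE := homE gH; have hE := homE hH.
exists g => // a.
(* The filter gives one implication; applied to [cp x] it gives the converse. Second components then
   follow by applying this to [st a]. *)
have g1 x : (g (f x)).1 = (h x).1.
  have imp y : (h y).1 -> (g (f y)).1.
    by move=> hy; apply: gP; exists y => //; apply: mtxx.
  apply/idP/idP; last exact: imp.
  apply: contraLR => nhx; have := imp (cp x).
  by rewrite hE fE gE !fourE /=; apply.
rewrite [RHS]surjective_pairing -g1 [LHS]surjective_pairing; congr pair.
by have := g1 (st a); rewrite fE gE hE !fourE.
Qed.
(** * Separating sets of homomorphisms *)

(** Such an [H] serves as a set of points of [M]. It will be the set of all homomorphisms for a
    given algebra, and the projections with their swaps for an algebra of functions; the formulas of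
    the axioms are decoded once for both. *)
Definition spectral (M : structure bdm) (H : (M -> four) -> Prop) : Prop :=
  [/\ forall h, H h -> hom h, exists h, H h
    & forall a b, (forall h, H h -> (h a).1 = (h b).1) -> a = b].

Lemma spectral_BDA (M : structure bdm) (H : (M -> four) -> Prop) :
  spectral H -> model M BDA.
Proof.
move=> [homH [h Hh] sepH] p [-> | [q qI ->]].
  rewrite /satisfies /= !interpE => /(congr1 h).
  by rewrite !(homE (homH h Hh)).
apply/satisfies_universal_closure => v.
have [s [t [-> st4]]] := four_identities qI.
by apply: sepH => g /homH gH; rewrite !hom_eval // st4.
Qed.

Lemma BDA_spectral (M : structure bdm) :
  model M BDA -> spectral (@hom bdm M four).
Proof.
move=> MB; split=> //; last exact: four_homs_separate.
(* Without homomorphisms, separation would vacuously identify [bt] and [tp]. *)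
apply: contrapT => no_hom; apply: (bt_neq_tp MB).
by apply: four_homs_separate => // h hH; case: no_hom; exists h.
Qed.

Section Spectral.
Variables (M : structure bdm) (H : (M -> four) -> Prop).
Hypothesis spH : spectral H.

Let homH h : H h -> hom h. Proof. by case: spH => + _ _; apply. Qed.

Lemma mt_eq_bt a b :
  mt a b = bt <-> ~ exists h, [/\ H h, (h a).1 & (h b).1].
Proof.
have [_ _ sepH] := spH; split=> [ab0 [h [Hh ha hb]] | nab].
  by have := congr1 h ab0; rewrite !(homE (homH Hh)) !fourE ha hb.
apply: sepH => h Hh; rewrite !(homE (homH Hh)) !fourE /=.
by apply/negbTE/andP => -[ha hb]; apply: nab; exists h.
Qed.

Lemma neq_bt a : a <> bt <-> exists2 h, H h & (h a).1.
Proof.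
have [_ _ sepH] := spH; split=> [na0 | [h Hh ha] a0]; last first.
  by move: ha; rewrite a0 (homE (homH Hh)).
apply: contrapT => nh; apply: na0; apply: sepH => h Hh.
rewrite (homE (homH Hh)) fourE /=.
by apply/negbTE/negP => ha; apply: nh; exists h.
Qed.

(* With [d = (p x, p (star x))], the elements [x * bar x], [x * star x] and
   [compl x * bar x] of [phi] cut out the points [p] where [d] is
   [(true, false)], [(true, true)] and [(false, false)]. *)
Definition meets (a x : M) (d : bool * bool) : Prop :=
  exists h, [/\ H h, (h a).1 & h x = d].

Lemma vanishing_patternP n (I : {set 'I_n}) (y : 'I_n -> M) x t d :
  (forall h, H h -> (h (eval (extend y x) t)).1 = (h x == d :> bool * bool)) ->
  holds (And (\big[And/Top]_(i < n | i \in I)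
                Eq (meet (Var (lift ord_max i)) t) zero)
             (\big[And/Top]_(i < n | i \notin I)
                Not (Eq (meet (Var (lift ord_max i)) t) zero))) (extend y x) <->
  forall i, i \in I <-> ~ meets (y i) x d.
Proof.
move=> td.
have tP i : holds (Eq (meet (Var (lift ord_max i)) t) zero) (extend y x) <->
    ~ meets (y i) x d.
  rewrite /holds evalE eval_zero mt_eq_bt [eval _ (Var _)]extend_lift.
  by apply: not_iff_compat; split=> -[h [Hh hy hx]]; exists h; split;
     rewrite // ?td ?hx // in hx *; apply/eqP.
split=> [[/holds_bigAnd inI /holds_bigAnd ninI] i | IP].
  split=> [/inI/tP // | nm]; apply/negPn/negP => /ninI; apply.
  exact/tP.
split; apply/holds_bigAnd => i iI; first by apply/tP/IP.
by move=> /tP/IP; apply/negP.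
Qed.

Lemma phiP n (I1 I2 I3 : {set 'I_n}) (y : 'I_n -> M) x :
  holds (phi I1 I2 I3) (extend y x) <->
  [/\ forall i, i \in I1 <-> ~ meets (y i) x (true, false),
      forall i, i \in I2 <-> ~ meets (y i) x (true, true)
    & forall i, i \in I3 <-> ~ meets (y i) x (false, false)].
Proof.
have xE : eval (extend y x) (Var ord_max) = x by exact: extend_max.
have P1 := @vanishing_patternP n I1 y x (Var ord_max * bar (Var ord_max))%fo
  (true, false).
have P2 := @vanishing_patternP n I2 y x (Var ord_max * star (Var ord_max))%fo
  (true, true).
have P3 := @vanishing_patternP n I3 y x
  (compl (Var ord_max) * bar (Var ord_max))%fo (false, false).
have d1 h : H h ->
    (h (eval (extend y x) (Var ord_max * bar (Var ord_max))%fo)).1 =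
    (h x == (true, false) :> bool * bool).
  move=> /homH hH; rewrite !evalE xE !(homE hH) !fourE /=.
  by case: (h x) => -[] [].
have d2 h : H h ->
    (h (eval (extend y x) (Var ord_max * star (Var ord_max))%fo)).1 =
    (h x == (true, true) :> bool * bool).
  move=> /homH hH; rewrite !evalE xE !(homE hH) !fourE /=.
  by case: (h x) => -[] [].
have d3 h : H h ->
    (h (eval (extend y x) (compl (Var ord_max) * bar (Var ord_max))%fo)).1 =
    (h x == (false, false) :> bool * bool).
  move=> /homH hH; rewrite !evalE xE !(homE hH) !fourE /=.
  by case: (h x) => -[] [].
rewrite /phi; split=> [[/(P1 d1) ? [/(P2 d2) ? /(P3 d3) ?]] // |].
by case=> /(P1 d1) ? /(P2 d2) ? /(P3 d3) ?.
Qed.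

Lemma eval_bigjoin1 n (I : finType) (F : I -> term bdm n) (w : 'I_n -> four) :
  (eval w (\big[@join n/zero]_i F i)).1 = [exists i, (eval w (F i)).1].
Proof.
rewrite (@big_morph _ _ (fun t => (eval w t).1) false orb zero (@join n)).
- by rewrite big_orE.
- by move=> s t; rewrite evalE fourE.
- by rewrite evalE fourE.
Qed.

(** Each equation is tested at the points [h]; the second component of [y i] is the first component
    of its star, hence of [y (s i)]. *)
Lemma star_partitionP n (s : 'S_n) (y : 'I_n -> M) :
  holds (star_partition s) y <->
  [/\ forall i, exists2 h, H h & (h (y i)).1,
      forall h, H h -> exists i, (h (y i)).1,
      forall h i j, H h -> (h (y i)).1 -> (h (y j)).1 -> i = j
    & forall h i, H h -> (h (y i)).2 = (h (y (s i))).1].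
Proof.
have [_ _ sepH] := spH.
have sumP h : H h ->
    (h (eval y (\big[@join n/zero]_i Var i))).1 = [exists i, (h (y i)).1].
  by move=> /homH hH; rewrite hom_eval // eval_bigjoin1.
rewrite /star_partition; split.
  case=> /holds_bigAnd y0 [sum1 [/holds_bigAnd disj /holds_bigAnd ys]].
  split=> [i | h Hh | h i j Hh hi hj | h i Hh].
  - apply/neq_bt => yi0; have: eval y (Var i) <> eval y zero := y0 i isT.
    by rewrite eval_zero; apply.
  - by apply/existsP; rewrite -sumP // sum1 evalE (homE (homH Hh)).
  - apply/eqP; apply: contraT => ij.
    have := disj i isT; move/holds_bigAnd => /(_ j ij).
    rewrite /holds !evalE => /mt_eq_bt[]; by exists h.
  - have /(congr1 (fun a => (h a).1)) := ys i isT.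
    by rewrite evalE (homE (homH Hh)) fourE.
case=> y0 sum1 disj ys; split; last split; last split.
- apply/holds_bigAnd => i _.
  suff: eval y (Var i) <> eval y zero by [].
  by rewrite eval_zero; apply/neq_bt/y0.
- apply: sepH => h Hh; rewrite sumP // evalE (homE (homH Hh)) fourE /=.
  by apply/existsP/sum1.
- apply/holds_bigAnd => i _; apply/holds_bigAnd => j ij.
  rewrite /holds !evalE; apply/mt_eq_bt => -[h [Hh hi hj]].
  by move/eqP: ij; apply; apply: disj hi hj.
- apply/holds_bigAnd => i _; rewrite /holds evalE; apply: sepH => h Hh.
  by rewrite (homE (homH Hh)) fourE /= ys.
Qed.

End Spectral.

(** * Types of tuples *)

Local Notation assignment n := {ffun 'I_n -> bool * bool}.

Definition flip n (e : assignment n) : assignment n :=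
  [ffun i => swap (e i)].

Definition ext n (e : assignment n) (d : bool * bool) :
    (assignment n.+1) :=
  [ffun j => oapp e d (unlift ord_max j)].

Definition restr n (e : assignment n.+1) :
    (assignment n) :=
  [ffun i => e (lift ord_max i)].

Lemma flipK n : involutive (@flip n).
Proof. by move=> e; apply/ffunP => i; rewrite !ffunE swapK. Qed.

Lemma restr_ext n (e : assignment n) d : restr (ext e d) = e.
Proof. by apply/ffunP => i; rewrite !ffunE liftK. Qed.

Lemma ext_restr n (e : assignment n.+1) :
  ext (restr e) (e ord_max) = e.
Proof.
apply/ffunP => j; rewrite ffunE; case: (unliftP ord_max j) => [i|] -> //=.
by rewrite ffunE.
Qed.

Lemma flip_ext n (e : assignment n) d :
  flip (ext e d) = ext (flip e) (swap d).
Proof.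
apply/ffunP => j; rewrite !ffunE.
by case: (unlift _ j) => //= i; rewrite ffunE.
Qed.

Definition literal n (b : bool) (t : term bdm n) : term bdm n :=
  if b then t else compl t.

(** The first component at a point sees only one of the two bits of a value; the literal of
    [star (Var i)] exposes the other. *)
Definition minterm n (e : assignment n) : term bdm n :=
  \big[@meet n/one]_i
    meet (literal (e i).1 (Var i)) (literal (e i).2 (star (Var i))).

Section Types.
Variable M : structure bdm.

Definition point_type n (v : 'I_n -> M) (h : M -> four) :
    (assignment n) := [ffun i => h (v i)].

Definition types n (v : 'I_n -> M) : {set assignment n} :=
  [set e | `[< exists2 h : M -> four, hom h & point_type v h = e >]].

Lemma typesP n (v : 'I_n -> M) e :
  reflect (exists2 h : M -> four, hom h & point_type v h = e) (e \in types v).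
Proof. by rewrite inE; apply: asboolP. Qed.

Lemma swap_comp_hom (h : M -> four) : hom h -> hom (swap \o h : M -> four).
Proof. by move=> hH; apply: hom_comp swap_hom hH. Qed.

Lemma point_type_swap n (v : 'I_n -> M) h :
  point_type v (swap \o h) = flip (point_type v h).
Proof. by apply/ffunP => i; rewrite !ffunE. Qed.

Lemma point_type_extend n (v : 'I_n -> M) a h :
  point_type (extend v a) h = ext (point_type v h) (h a).
Proof.
apply/ffunP => j; rewrite !ffunE /extend.
by case: (unlift _ j) => //= i; rewrite ffunE.
Qed.

Lemma hom_minterm n (v : 'I_n -> M) (h : M -> four) e : hom h ->
  h (eval v (minterm e)) = (point_type v h == e, flip (point_type v h) == e).
Proof.
(* The second component at [h] is the first component at [swap \o h]. *)
have m1 (g : M -> four) :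
    hom g -> (g (eval v (minterm e))).1 = (point_type v g == e).
  move=> gH; rewrite hom_eval //.
  have -> : (eval (g \o v) (minterm e)).1 =
      [forall i, g (v i) == e i :> bool * bool].
    rewrite (@big_morph _ _ (fun t => (eval (g \o v) t).1)
               true andb one (@meet n)).
    - rewrite big_andE; apply: eq_forallb => i.
      rewrite evalE fourE /literal [in RHS]/eq_op /=.
      by case: (e i) => -[] [] /=; rewrite ?evalE ?fourE /=;
        case: (g (v i)) => -[] [].
    - by move=> s t; rewrite evalE fourE.
    - by rewrite evalE fourE.
  apply/forallP/eqP => [ge | <- i]; last by rewrite ffunE.
  by apply/ffunP => i; rewrite ffunE; apply/eqP.
move=> hH; rewrite [LHS]surjective_pairing m1 //; congr pair.
by rewrite -point_type_swap -m1 //; apply: swap_comp_hom.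
Qed.

End Types.
(** * Quantifier elimination *)

Definition extends n (S : {set assignment n})
    (S' : {set assignment n.+1}) : bool :=
  (@flip _ @: S' == S') && (@restr _ @: S' == S).

Lemma imset_invol (T : finType) (f : T -> T) (A : {set T}) :
  involutive f -> (forall x, x \in A -> f x \in A) -> f @: A = A.
Proof.
move=> fK fA; apply/eqP; rewrite eqEcard card_imset ?leqnn ?andbT;
  last exact: inv_inj.
by apply/subsetP => _ /imsetP[x /fA xA ->].
Qed.

Lemma flip_types (M : structure bdm) n (v : 'I_n -> M) e :
  e \in types v -> flip e \in types v.
Proof.
move=> /typesP[h hH <-]; rewrite -point_type_swap; apply/typesP.
by exists (swap \o h) => //; apply: swap_comp_hom.
Qed.

Lemma types_extends (M : structure bdm) n (v : 'I_n -> M) a :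
  extends (types v) (types (extend v a)).
Proof.
apply/andP; split; apply/eqP.
  by apply: imset_invol (@flipK _) _; apply: flip_types.
apply/setP => e; apply/imsetP/typesP => [[_ /typesP[h hH <-] ->] | [h hH <-]].
  by exists h => //; rewrite point_type_extend restr_ext.
exists (point_type (extend v a) h); first by apply/typesP; exists h.
by rewrite point_type_extend restr_ext.
Qed.

Lemma ECBDA_BDA (M : structure bdm) : model M ECBDA -> model M BDA.
Proof. by move=> ME p Mp; apply: ME; constructor. Qed.

(** The nonzero minterms of [v] are indexed by [types v], [star] permutes them through [flip], and a
    value [d] is forbidden on a minterm when extending its type by [d] leaves [S']. The axiom for
    these data yields an element taking exactly the allowed values. *)
Lemma extends_types (M : structure bdm) n (v : 'I_n -> M) S' :
  model M ECBDA -> extends (types v) S' -> exists a, types (extend v a) = S'.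
Proof.
move=> ME /andP[/eqP flipS' /eqP restrS'].
have MB := ECBDA_BDA ME; have spM := BDA_spectral MB.
set S := types v in restrS'.
(* A base point: it supplies the default for [rk] and shows that [S] is nonempty, as the axiom
   demands [0 < n]. *)
have [h0 h0H] : exists h : M -> four, hom h by case: spM.
have tS (h : M -> four) : hom h -> point_type v h \in S.
  by move=> hH; apply/typesP; exists h.
have S'flip e : (flip e \in S') = (e \in S').
  by rewrite -{1}flipS' mem_imset //; apply: inv_inj (@flipK _).
pose ev (i : 'I_#|S|) : assignment n := enum_val i.
pose rk e : 'I_#|S| := enum_rank_in (tS h0 h0H) e.
have ev_inj : injective ev by exact: enum_val_inj.
have evP i : ev i \in S by exact: enum_valP.
have rkK e : e \in S -> ev (rk e) = e by exact: enum_rankK_in.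
pose s i := rk (flip (ev i)).
have sE i : ev (s i) = flip (ev i) by rewrite rkK //; apply/flip_types/evP.
have sK : involutive s by move=> i; apply: ev_inj; rewrite !sE flipK.
pose p : 'S_#|S| := perm (inv_inj sK).
have pE : p =1 s by move=> i; rewrite permE.
(* No condition is imposed on the value [(false, true)]: it is the swap of
   [(true, false)], which the invariance of [S'] takes care of. *)
pose I d : {set 'I_#|S|} := [set i | ext (ev i) d \notin S'].
have sI d : swap d = d -> p @: I d = I d.
  move=> dd; apply: imset_invol => [i | i]; rewrite !pE ?sK //.
  by rewrite !inE sE -{2}dd -flip_ext S'flip.
have cI : consistent p (I (true, false)) (I (true, true)) (I (false, false)).
  split; [exact: sI | exact: sI |].
  apply/setP => i; rewrite inE [RHS]inE; apply/negbTE/andP => -[].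
  rewrite !inE => /andP[/andP[iTF iTT] iFF] /imsetP[j].
  rewrite !inE => /andP[/andP[jTF _] _] ij.
  (* Some member of [S'] restricts to [ev i], so one of the four values is allowed there. Three are
     excluded directly, and [(false, true)] is excluded by flipping [jTF]. *)
  have /imsetP[e eS' eE] : ev i \in @restr _ @: S' by rewrite restrS' evP.
  rewrite -(ext_restr e) -eE in eS'.
  case: (e ord_max) eS' => -[] [];
    rewrite ?(negbTE iTF) ?(negbTE iTT) ?(negbTE iFF) //.
  by rewrite ij pE sE -S'flip flip_ext flipK (negbTE jTF).
pose y i := eval v (minterm (ev i)).
have y1 (h : M -> four) i : hom h -> (h (y i)).1 = (point_type v h == ev i).
  by move=> hH; rewrite hom_minterm.
have y2 (h : M -> four) i :
    hom h -> (h (y i)).2 = (flip (point_type v h) == ev i).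
  by move=> hH; rewrite hom_minterm.
have [x /(phiP spM)[x1 x2 x3]] : exists x,
    holds (phi (I (true, false)) (I (true, true)) (I (false, false)))
      (extend y x).
  have S_gt0 : 0 < #|S|.
    by rewrite card_gt0; apply/set0Pn; exists (point_type v h0); rewrite tS.
  have pp : (p * p)%g = 1%g.
    by apply/permP => i; rewrite permM !pE sK perm1.
  have := ME _ (ECBDA_extension S_gt0 pp cI).
  rewrite satisfies_universal_closure => /(_ y); apply.
  apply/(star_partitionP spM); split=> [i | h hH | h i j hH | h i hH].
  - have /typesP[h hH hE] := evP i; exists h => //.
    by rewrite y1 // hE.
  - by exists (rk (point_type v h)); rewrite y1 // rkK ?tS.
  - by rewrite !y1 // => /eqP-> /eqP/ev_inj.
  - rewrite y1 // y2 // pE sE.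
    by rewrite (can2_eq (@flipK _) (@flipK _)).
(* Swapping the point [h] turns the value [(false, true)] on part [i] into [(true, false)] on part
   [s i], so the three conditions of [phi] cover all four values. *)
have IP i d : i \in I d <-> ~ meets (@hom bdm M four) (y i) x d.
  have TFP j : j \in I (true, false) <->
      ~ meets (@hom bdm M four) (y j) x (true, false).
    exact: x1.
  case: d => -[] [] //.
  have -> : (i \in I (false, true)) = (s i \in I (true, false)).
    by rewrite !inE sE -S'flip flip_ext.
  rewrite TFP; apply: not_iff_compat.
  split=> -[h [hH hy hx]]; exists (swap \o h); split=> //=; rewrite ?hx //;
    try exact: swap_comp_hom.
    by move: hy; rewrite y1 // y2 // sE => /eqP->; rewrite flipK.
  by move: hy; rewrite y1 // y2 // sE => /eqP->.
exists x; apply/setP => e; apply/typesP/idP => [[h hH <-] | eS'].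
  pose i := rk (point_type v h).
  have iE : ev i = point_type v h by rewrite rkK ?tS.
  rewrite point_type_extend -iE; apply/negPn/negP => nS'.
  have /IP[] : i \in I (h x) by rewrite inE.
  by exists h; split; rewrite // y1 // iE.
have eS : restr e \in S by rewrite -restrS' imset_f.
have /IP/contrapT[h [hH]] : ~ rk (restr e) \in I (e ord_max).
  by rewrite inE rkK // ext_restr eS'.
rewrite y1 // rkK // => /eqP hE hx; exists h => //.
by rewrite point_type_extend hE hx ext_restr.
Qed.

(** * From sets of types to quantifier-free formulas *)

Lemma types_minterm (M : structure bdm) n (v : 'I_n -> M) e : model M BDA ->
  eval v (minterm e) <> eval v zero <-> e \in types v.
Proof.
move=> MB; rewrite eval_zero (neq_bt (BDA_spectral MB)).
split=> [[h hH] | /typesP[h hH hE]].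
  by rewrite hom_minterm //= => /eqP hE; apply/typesP; exists h.
by exists h; rewrite // hom_minterm //= hE.
Qed.

Definition diagram n (S : {set assignment n}) : formula bdm n :=
  And (\big[And/Top]_(e | e \in S) Not (Eq (minterm e) zero))
      (\big[And/Top]_(e | e \notin S) Eq (minterm e) zero).

Lemma holds_diagram (M : structure bdm) n (v : 'I_n -> M) S : model M BDA ->
  holds (diagram S) v <-> types v = S.
Proof.
move=> MB; split=> [[/holds_bigAnd inS /holds_bigAnd ninS] | <-].
  apply/setP => e; apply/idP/idP => [/(types_minterm _ _ MB) v0 | /inS].
    by apply: contraT => /ninS.
  by move=> ?; apply/(types_minterm _ _ MB).
split; apply/holds_bigAnd => e; first by move/(types_minterm _ _ MB).
by move=> ve; apply: contrapT => /(types_minterm _ _ MB); apply/negP.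
Qed.

(** Homomorphisms to [four] separate elements, and the value of a term under one of them depends
    only on the assignment it induces. *)
Lemma bda_term_types (M : structure bdm) n (s t : term bdm n) (v : 'I_n -> M) :
  model M BDA ->
  eval v s = eval v t <->
  [forall e in types v,
     eval (M := four) e s == eval (M := four) e t :> bool * bool].
Proof.
have pE (h : M -> four) : (point_type v h : 'I_n -> four) = h \o v.
  by apply: funext => i; rewrite ffunE.
move=> MB; split=> [st | /forall_inP st].
  apply/forall_inP => _ /typesP[h hH <-].
  by rewrite pE -!hom_eval // st.
apply: (four_homs_separate MB) => h hH.
have /st/eqP : point_type v h \in types v by apply/typesP; exists h.
by rewrite pE -!hom_eval // => ->.
Qed.

(** By induction: [types_extends] and [extends_types] turn a quantifier over [M] into a finite
    quantifier over the sets extending [types v]. That [D] is chosen before [M] is what yields one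
    equivalent formula for all models, and completeness. *)
Lemma formula_types n (p : formula bdm n) :
  exists D : {set assignment n} -> bool,
  forall M : structure bdm, model M ECBDA ->
  forall v : 'I_n -> M, holds p v <-> D (types v).
Proof.
elim: p => {n} [n | n s t | n p [D DP] q [E EP] | n p [D DP] q [E EP]
  | n p [D DP] q [E EP] | n p [D DP] | n p [D DP]].
- by exists (fun=> false).
- exists (fun S : {set assignment n} =>
    [forall e in S,
       eval (M := four) e s == eval (M := four) e t :> bool * bool]).
  by move=> M /ECBDA_BDA MB v; apply: bda_term_types.
- exists (fun S => D S && E S) => M ME v /=; rewrite DP // EP //.
  by split=> /andP.
- exists (fun S => D S || E S) => M ME v /=; rewrite DP // EP //.
  by split=> /orP.
- exists (fun S => D S ==> E S) => M ME v /=; rewrite DP // EP //.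
  by split=> /implyP.
- exists (fun S => [forall S', extends S S' ==> D S']) => M ME v /=.
  split=> [pv | /forallP DS a].
    apply/forallP => S'; apply/implyP => /(extends_types ME)[a <-].
    exact/DP.
  by apply/DP => //; apply: (implyP (DS _)); apply: types_extends.
- exists (fun S => [exists S', extends S S' && D S']) => M ME v /=.
  split=> [[a /DP Da] | /existsP[S' /andP[/(extends_types ME)[a <-] Da]]].
    apply/existsP; exists (types (extend v a)).
    by rewrite types_extends Da.
  by exists a; apply/DP.
Qed.

Lemma quantifier_free_bigAnd L n (I : finType) (P : pred I)
    (F : I -> formula L n) :
  (forall i, quantifier_free (F i)) ->
  quantifier_free (\big[And/Top]_(i | P i) F i).
Proof. by move=> FQ; elim/big_rec: _ => //= i p _ ->; rewrite FQ. Qed.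

Lemma quantifier_free_bigOr L n (I : finType) (P : pred I)
    (F : I -> formula L n) :
  (forall i, quantifier_free (F i)) ->
  quantifier_free (\big[Or/Bot]_(i | P i) F i).
Proof. by move=> FQ; elim/big_rec: _ => //= i p _ ->; rewrite FQ. Qed.

Lemma ECBDA_eliminates_quantifiers : eliminates_quantifiers ECBDA.
Proof.
move=> n p; have [D DP] := formula_types p.
exists (\big[Or/Bot]_(S | D S) diagram S).
  apply: quantifier_free_bigOr => S /=.
  by rewrite !quantifier_free_bigAnd.
move=> M ME v; rewrite DP // holds_bigOr; have MB := ECBDA_BDA ME.
split=> [Dv | [S DS /(holds_diagram _ _ MB)->] //].
by exists (types v) => //; apply/(holds_diagram _ _ MB).
Qed.

Lemma eliminates_quantifiers_model_complete L (T : theory L) :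
  eliminates_quantifiers T -> model_complete T.
Proof.
move=> TQ n p; have [q qQ pq] := TQ n p; exists q => //.
by case: {p pq} q qQ.
Qed.

Lemma types_empty (M : structure bdm) (v : 'I_0 -> M) : model M BDA ->
  types v = setT.
Proof.
move=> /BDA_spectral[_ [h hH] _]; apply/setP => e; rewrite [RHS]inE.
by apply/typesP; exists h => //; apply/ffunP; case.
Qed.

Lemma ECBDA_decides (p : sentence bdm) :
  entails ECBDA p \/ entails ECBDA (Not p).
Proof.
have [D DP] := formula_types p.
have pE M (ME : model M ECBDA) : satisfies M p <-> D setT.
  by rewrite /satisfies DP // types_empty //; apply: ECBDA_BDA.
case: (boolP (D setT)) => DT; [left | right] => M ME; first exact/pE.
by move/(pE M ME); apply/negP.
Qed.
(** * Amalgamation and embeddings *)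

Section PowerSubalgebra.
Variables (Y : Type) (K : (Y -> four) -> Prop).
Hypothesis K_closed :
  forall (s : bdm_symbol) (a : 'I_(bdm_arity s) -> Y -> four),
  (forall i, K (a i)) -> K (fun y => @interp bdm four s (fun i => a i y)).

Definition power_op (s : bdm_symbol) (a : 'I_(bdm_arity s) -> {f | K f}) :
    {f | K f} :=
  exist K _ (K_closed (fun i => svalP (a i))).

(** The predicate [K] lets one construction serve twice: the full power for amalgamation, the
    finitely dependent functions for embedding. *)
Definition power_algebra : structure bdm :=
  @Structure bdm {f | K f} power_op
    (inhabits (@power_op ZeroSym (tnth [tuple]))).

Definition power_point (y : Y) (f : power_algebra) : four := sval f y.

Lemma power_point_hom y : hom (power_point y).
Proof. by []. Qed.

(** Swapped projections are included because separation compares first components only, and swapping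
    brings the second one forward. *)
Definition power_homs (h : power_algebra -> four) : Prop :=
  exists y, h = power_point y \/ h = swap \o power_point y.

Lemma power_spectral : inhabited Y -> spectral power_homs.
Proof.
case=> y0; split=> [_ [y [] ->] | | f g fg].
- exact: power_point_hom.
- by apply: swap_comp_hom (power_point_hom y).
- by exists (power_point y0), y0; left.
case: f g fg => [f Kf] [g Kg] fg; apply: eq_exist; apply: funext => y.
rewrite [LHS]surjective_pairing [RHS]surjective_pairing; congr pair.
  by apply: (fg (power_point y)); exists y; left.
by apply: (fg (swap \o power_point y)); exists y; right.
Qed.

End PowerSubalgebra.

(** Elements of [M1] and [M2] act by evaluation on the pairs in [Y]. These maps are injective
    because [four_hom_extension] completes every homomorphism on one side to such a pair. *)
Lemma BDA_amalgamation : amalgamation BDA.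
Proof.
move=> M0 M1 M2 f1 f2 M0B M1B M2B f1E f2E.
pose Y := {q : (M1 -> four) * (M2 -> four) |
  [/\ hom q.1, hom q.2 & forall a, q.1 (f1 a) = q.2 (f2 a)]}.
pose K (f : Y -> four) := True.
have KC : forall (s : bdm_symbol) (a : 'I_(bdm_arity s) -> Y -> four),
  (forall i, K (a i)) -> K (fun y => @interp bdm four s (fun i => a i y)) by [].
have ext1 (h : M1 -> four) : hom h -> exists y : Y, (sval y).1 = h.
  move=> hH.
  have [g gH gf] := four_hom_extension M0B M2B f2E (hom_comp hH (proj2 f1E)).
  have hg : [/\ hom (h, g).1, hom (h, g).2
      & forall a, (h, g).1 (f1 a) = (h, g).2 (f2 a)].
    by split=> // a; rewrite /= gf.
  by exists (exist _ (h, g) hg).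
have ext2 (h : M2 -> four) : hom h -> exists y : Y, (sval y).2 = h.
  move=> hH.
  have [g gH gf] := four_hom_extension M0B M1B f1E (hom_comp hH (proj2 f2E)).
  have gh : [/\ hom (g, h).1, hom (g, h).2
      & forall a, (g, h).1 (f1 a) = (g, h).2 (f2 a)].
    by split=> // a; rewrite /= gf.
  by exists (exist _ (g, h) gh).
pose g1 (a : M1) : power_algebra KC := exist K (fun y => (sval y).1 a) I.
pose g2 (a : M2) : power_algebra KC := exist K (fun y => (sval y).2 a) I.
exists (power_algebra KC), g1, g2; split.
- apply: spectral_BDA (power_spectral KC _).
  have [_ [h /ext1[y _]] _] := BDA_spectral M1B.
  exact: inhabits.
- split=> [a b ab | s a].
    apply: (four_homs_separate M1B) => h /ext1[y <-].
    by have := congr1 (fun f => (power_point y f).1) ab.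
  by apply: eq_exist; apply: funext => y; have [-> _ _] := svalP y.
- split=> [a b ab | s a].
    apply: (four_homs_separate M2B) => h /ext2[y <-].
    by have := congr1 (fun f => (power_point y f).1) ab.
  by apply: eq_exist; apply: funext => y; have [_ -> _] := svalP y.
- move=> a; apply: eq_exist; apply: funext => y.
  by have [_ _ ->] := svalP y.
Qed.

(** * A model of [ECBDA] above every Boole-De Morgan algebra *)

Section CantorPower.
Variable X : Type.

(** The bound [k] is uniform over [X], so finitely many such functions leave a common coordinate
    free at all points. *)
Definition finitely_dependent (f : (nat -> bool * bool) * X -> four) : Prop :=
  exists k, forall c d q, (forall i, i < k -> c i = d i) -> f (c, q) = f (d, q).

Lemma finitely_dependent_family (I : finType)
    (f : I -> (nat -> bool * bool) * X -> four) :
  (forall i, finitely_dependent (f i)) ->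
  exists k, forall i c d q,
    (forall j, j < k -> c j = d j) -> f i (c, q) = f i (d, q).
Proof.
move=> /fin_all_exists[k kP]; exists (\max_i k i) => i c d q cd.
by apply: kP => j ji; apply: cd; apply: leq_trans ji (leq_bigmax i).
Qed.

Lemma finitely_dependent_closed (s : bdm_symbol)
    (a : 'I_(bdm_arity s) -> (nat -> bool * bool) * X -> four) :
  (forall i, finitely_dependent (a i)) ->
  finitely_dependent (fun y => @interp bdm four s (fun i => a i y)).
Proof.
move=> /finitely_dependent_family[k kP]; exists k => c d q cd; congr interp.
by apply: funext => i; apply: kP.
Qed.

Definition cantor_power : structure bdm :=
  power_algebra finitely_dependent_closed.

(** The witness reads its value off a fresh coordinate and corrects it to one allowed on the part
    containing the point. Varying that coordinate realizes every allowed value. *)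
Lemma cantor_power_extension n (s : 'S_n) (I1 I2 I3 : {set 'I_n}) :
  inhabited X -> (s * s)%g = 1%g -> consistent s I1 I2 I3 ->
  satisfies cantor_power (extension_axiom s I1 I2 I3).
Proof.
case=> q0 /permP ss [sI2 sI3 sI].
have spH := @power_spectral _ _ finitely_dependent_closed
  (inhabits (fun=> (true, true), q0)).
apply/satisfies_universal_closure => y.
case/(star_partitionP spH) => y0 ycover ydisj ystar.
have sK : involutive s by move=> i; have := ss i; rewrite permM perm1.
(* [x] may take the value [d] where the first component of [y i] is [true] iff
   [A i d]; applying [swap] reduces the value [(false, true)] to the value
   [(true, false)] on the part [s i]. *)
pose A i (d : bool * bool) : bool := match d with
  | (true, false) => i \notin I1 | (true, true) => i \notin I2
  | (false, false) => i \notin I3 | (false, true) => s i \notin I1 end.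
have As i d : A (s i) (swap d) = A i d.
  case: d => -[] [] /=; rewrite ?sK //.
    by rewrite -{1}sI2 mem_imset //; apply: perm_inj.
  by rewrite -{1}sI3 mem_imset //; apply: perm_inj.
(* If all four values were forbidden, invariance of [I2] and [I3] would put both [i] and [s i] in
   [I1 :&: I2 :&: I3], against consistency. *)
have A0 i : exists d, A i d.
  apply: contrapT => nA.
  have nA' d : ~~ A i d by apply/negP => Ad; apply: nA; exists d.
  move/setP/(_ i): sI; rewrite !inE.
  rewrite (negbNE (nA' (true, false))) (negbNE (nA' (true, true))).
  rewrite (negbNE (nA' (false, false))) /= => /negP[].
  rewrite -[i]sK mem_imset ?inE; last exact: perm_inj.
  rewrite -sI2 -sI3 !mem_imset; try exact: perm_inj.
  rewrite (negbNE (nA' (true, true))) (negbNE (nA' (false, false))).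
  by rewrite (negbNE (nA' (false, true))).
(* A retraction of all values onto those allowed on part [i]; by [A0] the default of [odflt] is
   never reached. *)
pose pr i d := if A i d then d else odflt d [pick d | A i d].
have prA i d : A i (pr i d).
  rewrite /pr; case: ifP => // _; case: pickP => //= nA.
  by have [e] := A0 i; rewrite nA.
have pr_id i d : A i d -> pr i d = d by rewrite /pr => ->.
pose at1 i z := (sval (y i) z).1.
have ptH z : power_homs (power_point z : cantor_power -> four).
  by exists z; left.
(* [ix z] is the index of the part containing the point [z]. *)
have /choice[ix ixP] : forall z, exists i, at1 i z.
  by move=> z; apply: (ycover _ (ptH z)).
have ix_eq i z : at1 i z -> ix z = i.
  by move=> iz; apply: ydisj (ptH z) (ixP z) iz.
have at2 i z : (sval (y i) z).2 = at1 (s i) z by exact: ystar _ i (ptH z).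
have [k kP] := finitely_dependent_family (fun i => svalP (y i)).
have ix_dep c d q : (forall j, j < k -> c j = d j) -> ix (c, q) = ix (d, q).
  by move=> cd; apply: ix_eq; rewrite /at1 (kP _ c d) //; apply: ixP.
(* [k] is a coordinate on which no [y i] depends. *)
have xK : finitely_dependent (fun z => pr (ix z) (z.1 k)).
  exists k.+1 => c d q cd; rewrite /= cd // (ix_dep c d) // => j jk.
  by apply: cd; apply: ltnW.
pose x : cantor_power := exist _ _ xK.
(* Overwriting coordinate [k] by [d] changes no [y i], so the point stays in its part while [x]
   takes the value [d]. *)
have x_surj i d c q : A i d -> at1 i (c, q) ->
    exists2 z, at1 i z & power_point z x = d.
  move=> Ad ic; pose c' j := if j == k then d else c j.
  have cc' j : j < k -> c' j = c j.
    by rewrite /c'; case: eqP => // ->; rewrite ltnn.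
  have ic' : at1 i (c', q) by rewrite /at1 (kP _ c' c).
  exists (c', q) => //.
  by rewrite /power_point /= (ix_eq i) // /c' eqxx pr_id.
(* At a swapped projection the relevant part is [s i] and the value is [swap d]; [As] brings both
   back. *)
have meetsP i d :
    meets (@power_homs _ _ finitely_dependent_closed) (y i) x d <-> A i d.
  split=> [[_ [[z [] ->] iz <-]] | Ad].
  - by rewrite -(ix_eq i z iz); apply: prA.
  - rewrite -As -[swap _]/(swap (swap (power_point z x))) swapK.
    rewrite /= [X in is_true X]at2 in iz.
    by rewrite -(ix_eq _ _ iz); apply: prA.
  have [_ [[c q] [] ->] iz] := y0 i.
    have [z yz xz] := x_surj i d c q Ad iz.
    by exists (power_point z); split.
  rewrite /= [X in is_true X]at2 in iz; rewrite -As in Ad.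
  have [z yz xz] := x_surj _ _ c q Ad iz.
  exists (swap \o power_point z); split; first by exists z; right.
    by rewrite /= [X in is_true X]at2.
  by rewrite -[LHS]/(swap (power_point z x)) xz swapK.
exists x; apply/(phiP spH); split=> i; rewrite meetsP /=;
  by split=> [-> // | /negP/negPn].
Qed.

Lemma cantor_power_ECBDA : inhabited X -> model cantor_power ECBDA.
Proof.
move=> X0 _ [p pB | n s I1 I2 I3 _ ss cI]; last exact: cantor_power_extension.
apply: (spectral_BDA (power_spectral finitely_dependent_closed _)) pB.
by case: X0 => q0; apply: (inhabits (fun=> (true, true), q0)).
Qed.

End CantorPower.

Lemma BDA_embeds_ECBDA (M : structure bdm) : model M BDA ->
  exists2 N : structure bdm, model N ECBDA & embeds M N.
Proof.
move=> MB; pose X := {h : M -> four | hom h}.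
exists (cantor_power X).
  apply: cantor_power_ECBDA; have [_ [h hH] _] := BDA_spectral MB.
  exact: (inhabits (exist _ h hH)).
(* Elements of [M] act by evaluation on the second factor alone, so the bound is 0. *)
have fK (a : M) : finitely_dependent (fun z : _ * X => sval z.2 a) by exists 0.
exists (fun a => exist _ _ (fK a)); split=> [a b | s a].
  case=> ab; apply: (four_homs_separate MB) => h hH.
  by have := congr1 (fun f => f (fun=> (true, true), exist _ h hH)) ab => /= ->.
by apply: eq_exist; apply: funext => -[c [h hH]].
Qed.

(** The identity and [swap] together separate the points of [four]. *)
Lemma four_BDA : model four BDA.
Proof.
apply: (@spectral_BDA four (@hom bdm four four)); split=> //.
  by exists id.
move=> a b ab; rewrite [a]surjective_pairing [b]surjective_pairing.
by congr pair; [apply: (ab id) | apply: (ab swap swap_hom)].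
Qed.

Theorem theorem4p11 :
  model_completion ECBDA BDA /\ complete ECBDA /\ eliminates_quantifiers ECBDA.
Proof.
have QE := ECBDA_eliminates_quantifiers.
do !split=> //.
- exact: BDA_amalgamation.
- exact: eliminates_quantifiers_model_complete.
- exact: BDA_embeds_ECBDA.
- move=> M /ECBDA_BDA MB; exists M => //; exists id; by split.
(* Satisfiability: [four] embeds into some model of [ECBDA]. *)
- by have [N NE _] := BDA_embeds_ECBDA four_BDA; exists N.
- exact: ECBDA_decides.
Qed.
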